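(* Let $k\geq 3$ and $n=2k+1$. Let $\sigma:[n]\to[n]$ be the circular shift $\sigma(i)=i+1$ for $1\le i\le n-1$ and $\sigma(n)=1$, and for $A\subset[n]$ write $\sigma(A)=\{\sigma(a):a\in A\}$. Let $L_3=\{1,2,4\}$ and, for $k\geq 4$, $L_k=\{1,2,4\}\cup\{7,9,11,\ldots,2k-1\}$. Let $\mathcal{F}_k=\{\sigma^i(L_k): i=0,1,\ldots,n-1\}$, let $\mathcal{Q}_k=\{A\subset[n]: |A|\geq k+1\}$, let $\bar{\mathcal{F}}_k=\{[n]\setminus A: A\in\mathcal{F}_k\}$, and let $$\mathcal{P}_k=\mathcal{F}_k\cup(\mathcal{Q}_k\setminus\bar{\mathcal{F}}_k).$$ Then $\mathcal{P}_k$ is a regular intersecting family and $\mathrm{div}(\mathcal{P}_k)=\mathrm{div}(\mathcal{Q}_k)+1$, where $\mathrm{div}(\mathcal{Q}_k)=\sum_{i=k+1}^{2k}\binom{2k}{i}$.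
   Context: $[n]=\{1,\ldots,n\}$ and $2^{[n]}$ is the family of all subsets of $[n]$. A family $\mathcal{F}\subset 2^{[n]}$ is intersecting if any two of its members have nonempty intersection. The degree of $x\in[n]$ in $\mathcal{F}$ is the number of members of $\mathcal{F}$ containing $x$; $\mathcal{F}$ is regular if all $x\in[n]$ have the same degree. For an intersecting family $\mathcal{F}$, its diversity is $\mathrm{div}(\mathcal{F})=|\mathcal{F}|-\max_{x\in[n]}|\mathcal{F}(x)|$, where $\mathcal{F}(x)=\{F\in\mathcal{F}: x\in F\}$. *)

(* Defs.v *)
From mathcomp Require Import all_boot.

Set Implicit Arguments.
Unset Strict Implicit.
Unset Printing Implicit Defensive.

(* The ground set [n] = {1, ..., n} is represented by 'I_n = {0, ..., n-1}:
   the ordinal x stands for the element x + 1, its label. *)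
Definition label (n : nat) (x : 'I_n) : nat := x.+1.

Section Families.
Variable n : nat.
Implicit Types (F : {set {set 'I_n}}) (x : 'I_n).

(* A and B may coincide, so an intersecting family omits the empty set. *)
Definition intersecting F : Prop :=
  forall A B, A \in F -> B \in F -> A :&: B != set0.

Definition star F x : {set {set 'I_n}} := [set A in F | x \in A].

Definition degree F x : nat := #|star F x|.

Definition regular F : Prop := forall x y, degree F x = degree F y.

(* The truncated subtraction is exact, since degree F x <= #|F|. *)
Definition diversity F : nat := #|F| - \max_(x : 'I_n) degree F x.

End Families.

Section Construction.
Variables n k : nat.

(* ordS sends x to x.+1 %% n, i.e. label i to label i + 1 and label n to 1. *)
Definition shift (A : {set 'I_n}) : {set 'I_n} := [set ordS a | a in A].

(* For k = 3 the range 7 <= label x <= 2 * k - 1 is empty. *)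
Definition Lset : {set 'I_n} :=
  [set x : 'I_n | (label x \in [:: 1; 2; 4])
               || [&& odd (label x), 7 <= label x & label x <= 2 * k - 1]].

Definition Ffam : {set {set 'I_n}} := [set iter i shift Lset | i : 'I_n].

Definition Qfam : {set {set 'I_n}} := [set A : {set 'I_n} | k + 1 <= #|A|].

Definition Fbar : {set {set 'I_n}} := [set ~: A | A in Ffam].

Definition Pfam : {set {set 'I_n}} := Ffam :|: (Qfam :\: Fbar).

End Construction.

(* Main.v *)
Require Import Defs.
From mathcomp Require Import all_boot zify.

Set Implicit Arguments.
Unset Strict Implicit.
Unset Printing Implicit Defensive.

(** The differences of two elements of [L_k] cover [Z_n], so any two shifts of
    [L_k] meet; a [k]-set misses only one set of size at least [k + 1], its own
    complement, and that is why these complements are removed. All families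
    involved are invariant under the shift, hence regular, and the diversity of
    a regular family is the number of members avoiding any given point [x].
    Double counting gives [n * deg F_k = |F_k| * k]; as [n = 2k + 1] is coprime
    to [k] this forces [|F_k| = n] and [deg F_k = k]. Passing from [Q_k] to
    [P_k] thus adds [n - k = k + 1] sets avoiding [x] and removes [k]. *)

Section Families.
Variable n : nat.
Implicit Types (G : {set {set 'I_n}}) (A : {set 'I_n}) (x : 'I_n).

(** * Degrees and diversity *)

Definition avoid G x : {set {set 'I_n}} := [set A in G | x \notin A].

Lemma degree_avoid G x : degree G x + #|avoid G x| = #|G|.
Proof.
rewrite -(cardsID [set A : {set 'I_n} | x \in A] G) /degree.
by congr (_ + _); apply: eq_card => A; rewrite !inE // andbC.
Qed.

Lemma regular_diversity G x : regular G -> diversity G = #|avoid G x|.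
Proof.
move=> regG; rewrite /diversity -(degree_avoid G x).
suff -> : \max_(y : 'I_n) degree G y = degree G x by rewrite addKn.
apply/eqP; rewrite eqn_leq (leq_bigmax x) andbT.
by apply/bigmax_leqP => y _; rewrite (regG y x).
Qed.

(** Double counting of the pairs $(x, A)$ with $x \in A \in G$. *)
Lemma sum_degree G : \sum_x degree G x = \sum_(A in G) #|A|.
Proof.
under eq_bigr => x _.
  rewrite /degree -sum1_card.
  under eq_bigl => A do rewrite inE.
  over.
rewrite (exchange_big_dep (mem G)) /= => [|x A _ /andP[] //].
apply: eq_bigr => A AG; rewrite -sum1_card.
by apply: eq_bigl => x; rewrite AG.
Qed.

(** * The cyclic shift and families closed under it *)

Lemma val_iter_ordS i x : iter i (@ordS n) x = (x + i) %% n :> nat.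
Proof.
elim: i => [|i IHi]; first by rewrite addn0 modn_small.
by rewrite iterS /= IHi -addn1 modnDml addn1 addnS.
Qed.

Lemma shift_inj : injective (@shift n).
Proof. by apply: imset_inj; apply: ordS_inj. Qed.

Lemma card_shift A : #|shift A| = #|A|.
Proof. by apply: card_imset; apply: ordS_inj. Qed.

Lemma shiftC A : shift (~: A) = ~: shift A.
Proof.
apply/setP => x; rewrite -(ord_predK x) inE.
by rewrite !mem_imset ?inE //; apply: ordS_inj.
Qed.

Lemma iter_shift i A : iter i (@shift n) A = [set iter i (@ordS n) a | a in A].
Proof.
elim: i => [|i IHi]; first by rewrite imset_id.
by rewrite iterS IHi /shift -imset_comp.
Qed.

Lemma iter_shift_order A : iter n (@shift n) A = A.
Proof.
rewrite iter_shift -[RHS]imset_id; apply: eq_imset => x; apply: val_inj.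
by rewrite /= val_iter_ordS modnDr modn_small.
Qed.

Definition shift_closed G := forall A, A \in G -> shift A \in G.

(** The shift injects the star of [x] into the star of [ordS x], so degrees do not decrease along
    the cycle; going round it, all are equal. *)
Lemma shift_closed_regular G : shift_closed G -> regular G.
Proof.
move=> clG.
have stepG x : degree G x <= degree G (ordS x).
  rewrite /degree -(card_imset (star G x) shift_inj) subset_leq_card //.
  apply/subsetP => _ /imsetP[A /[!inE] /andP[AG xA] ->].
  by rewrite clG //= imset_f.
have leG x y : degree G x <= degree G y.
  (* The step count is congruent to $y - x$ modulo $n$ and stays exact when $y < x$. *)
  have -> : y = iter (y + (n - x)) (@ordS n) x.
    apply: val_inj; rewrite /= val_iter_ordS.
    have -> : x + (y + (n - x)) = y + n by have := ltn_ord x; lia.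
    by rewrite modnDr modn_small.
  elim: (y + _) => [|i IHi] //; exact: leq_trans IHi (stepG _).
by move=> x y; apply/eqP; rewrite eqn_leq !leG.
Qed.

(** By finiteness, an injective shift mapping [G] into itself permutes [G]. *)
Lemma shift_closed_mem G A : shift_closed G -> (shift A \in G) = (A \in G).
Proof.
move=> clG; suff {1}<- : [set shift B | B in G] = G.
  by rewrite mem_imset //; apply: shift_inj.
apply/eqP; rewrite eqEcard (card_imset _ shift_inj) leqnn andbT.
by apply/subsetP => _ /imsetP[B BG ->]; apply: clG.
Qed.

Variable k : nat.

Lemma mem_Fbar A : (A \in Fbar n k) = (~: A \in Ffam n k).
Proof. by rewrite -[A in LHS]setCK mem_imset //; apply: setC_inj. Qed.

Lemma Ffam_closed : shift_closed (Ffam n k).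
Proof.
move=> _ /imsetP[i _ ->]; rewrite -iterS.
have [lt_in | le_ni] := ltnP i.+1 n.
  by apply/imsetP; exists (Ordinal lt_in).
(* After the last index the orbit wraps around to index 0. *)
have -> : i.+1 = n by apply/eqP; rewrite eqn_leq le_ni ltn_ord.
rewrite iter_shift_order; apply/imsetP.
by exists (Ordinal (leq_ltn_trans (leq0n i) (ltn_ord i))).
Qed.

Lemma Qfam_closed : shift_closed (Qfam n k).
Proof. by move=> A; rewrite !inE card_shift. Qed.

Lemma Pfam_closed : shift_closed (Pfam n k).
Proof.
move=> A; rewrite !in_setU !in_setD !mem_Fbar -shiftC.
rewrite !(shift_closed_mem _ Ffam_closed) (shift_closed_mem _ Qfam_closed).
by [].
Qed.

Lemma card_Ffam_le : #|Ffam n k| <= n.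
Proof. by rewrite -[leqRHS]card_ord leq_imset_card. Qed.

Lemma card_mem_Ffam A : A \in Ffam n k -> #|A| = #|Lset n k|.
Proof.
case/imsetP => i _ ->; elim: (i : nat) => //= j IHj.
by rewrite card_shift.
Qed.

End Families.

(** * The set $L_k$ and the intersection property for $n = 2k + 1$ *)

Section OddGroundSet.
Variable k : nat.
Hypothesis k_ge3 : 3 <= k.
Let n := (2 * k).+1.
Implicit Types (A B : {set 'I_n}) (x : 'I_n).

Lemma card_ground : #|'I_n| = (2 * k).+1.
Proof. exact: card_ord. Qed.

Lemma mem_Lset x :
  (x \in Lset n k) =
  [|| x == 0 :> nat, x == 1 :> nat, x == 3 :> nat
    | [&& ~~ odd x, 6 <= x & x <= 2 * k - 2]].
Proof. by rewrite !inE /label; lia. Qed.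

Lemma card_Lset : #|Lset n k| = k.
Proof.
(* Increasing enumeration of $L_k$ in values, that is labels minus one: 0, 1, 3, 6, 8, ..., $2k -
   2$. *)
pose g j := if j <= 1 then j else if j == 2 then 3 else 2 * j.
have g_lt (j : 'I_k) : g j < n by rewrite /g /n; have := ltn_ord j; do 2?case: ifP; lia.
pose f (j : 'I_k) : 'I_n := Ordinal (g_lt j).
have f_inj : injective f.
  by move=> i j /(congr1 val) /= gij; apply: val_inj; move: gij; rewrite /g /=;
    do 4?case: ifP; lia.
suff -> : Lset n k = f @: setT by rewrite card_imset // cardsT card_ord.
apply/setP => x; rewrite mem_Lset; apply/idP/imsetP => [Lx | [j _ ->]]; last first.
  by rewrite /= /g; have := ltn_ord j; do 2?case: ifP; lia.
have [j j_lt x_gj] : exists2 j, j < k & x = g j :> nat.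
  case/or4P: Lx => [/eqP->|/eqP->|/eqP->|Lx].
  - by exists 0 => //; lia.
  - by exists 1 => //; lia.
  - by exists 2.
  by exists x./2; rewrite /g; do 2?case: ifP; lia.
by exists (Ordinal j_lt) => //; apply: val_inj.
Qed.

(** Swapping [a] and [b] turns the difference $d$ into $n - d$, so it suffices to realise every $d
    \le k$. *)
Lemma Lset_difference d : d < n ->
  exists a b, [/\ a \in Lset n k, b \in Lset n k & a = b + d %[mod n]].
Proof.
pose good d := exists a b : nat,
  [/\ a < n, b < n, [|| a == 0, a == 1, a == 3 | [&& ~~ odd a, 6 <= a & a <= 2 * k - 2]],
      [|| b == 0, b == 1, b == 3 | [&& ~~ odd b, 6 <= b & b <= 2 * k - 2]]
    & a = b + d %[mod n]].
suff goodP e : e < n -> good e.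
  case/goodP => a [b [a_lt b_lt La Lb eq_ab]].
  by exists (Ordinal a_lt), (Ordinal b_lt); rewrite !mem_Lset.
(* The values 0, 1, 3 give the differences up to 3. The difference 4 wraps around: $(2k - 2) + 4 = n
   + 1$. From 5 on, an even $e'$ is $e' - 0$ and an odd one is $(e' + 1) - 1$. *)
have small e' : e' <= k -> good e'.
  move=> le_ek.
  have [->|e1] := eqVneq e' 0; first by exists 0, 0; split; rewrite /n //; lia.
  have [->|e2] := eqVneq e' 1; first by exists 1, 0; split; rewrite /n //; lia.
  have [->|e3] := eqVneq e' 2; first by exists 3, 1; split; rewrite /n //; lia.
  have [->|e4] := eqVneq e' 3; first by exists 3, 0; split; rewrite /n //; lia.
  have [e5|e5] := eqVneq e' 4.
    exists 1, (2 * k - 2); split; rewrite /n //; try lia.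
    by rewrite (_ : 2 * k - 2 + e' = 1 + (2 * k).+1) ?modnDr //; lia.
  case: (boolP (odd e')) => odd_e.
    by exists e'.+1, 1; split; rewrite /n ?add1n //; lia.
  by exists e', 0; split; rewrite /n ?add0n //; lia.
move=> lt_en; have [/small // | lt_ke] := leqP e k.
have /small[a [b [a_lt b_lt La Lb eq_ab]]] : n - e <= k by rewrite /n; lia.
exists b, a; split=> //; apply/esym.
by rewrite -modnDml eq_ab modnDml -addnA subnK ?modnDr // ltnW.
Qed.

Lemma Ffam_intersecting : intersecting (Ffam n k).
Proof.
move=> _ _ /imsetP[i _ ->] /imsetP[j _ ->].
wlog le_ij : i j / i <= j.
  move=> IH; have [/IH // | /ltnW /IH] := leqP i j.
  by rewrite setIC.
have d_lt : j - i < n by apply: leq_ltn_trans (leq_subr _ _) (ltn_ord j).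
have [a [b [La Lb eq_ab]]] := Lset_difference d_lt.
(* The common point is $a + i = b + j$ modulo $n$, since $a - b = j - i$. *)
apply/set0Pn; exists (iter i (@ordS n) a).
rewrite !iter_shift inE imset_f //=; apply/imsetP; exists b => //.
apply: val_inj; rewrite /= !val_iter_ordS.
by rewrite -modnDml eq_ab modnDml -addnA subnK.
Qed.

Lemma Ffam_card A : A \in Ffam n k -> #|A| = k.
Proof. by move/card_mem_Ffam; rewrite card_Lset. Qed.

Lemma Ffam_Qfam_meet A B :
  A \in Ffam n k -> B \in Qfam n k :\: Fbar n k -> A :&: B != set0.
Proof.
move=> FA; rewrite in_setD mem_Fbar inE => /andP[FB le_kB].
apply: contraNneq FB => AB0.
(* If [B] misses [A], then [~: B] contains [A] and has at most $n - (k + 1) = k$ elements, hence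
   equals [A]. *)
suff -> : ~: B = A by [].
apply/esym/eqP; rewrite eqEcard -disjoints_subset -setI_eq0 AB0 eqxx /=.
by rewrite cardsCs setCK card_ground (Ffam_card FA) leq_subLR
  (leq_trans _ (leq_add le_kB (leqnn k))) //; lia.
Qed.

Lemma Pfam_intersecting : intersecting (Pfam n k).
Proof.
move=> A B /setUP[FA | QA] /setUP[FB | QB].
- exact: Ffam_intersecting.
- exact: Ffam_Qfam_meet.
- by rewrite setIC; apply: Ffam_Qfam_meet.
move: QA QB; rewrite !inE => /andP[_ le_kA] /andP[_ le_kB].
(* Disjoint [A] and [B] would have a union of at least $2k + 2 > n$ elements. *)
have := leq_add le_kA le_kB; rewrite -cardsUI; apply: contraTneq => ->.
by rewrite cards0 addn0 -ltnNge (leq_ltn_trans (max_card _)) // card_ground; lia.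
Qed.

(** * Counting the members that avoid a point *)

Lemma Ffam_card_degree x : #|Ffam n k| = n /\ degree (Ffam n k) x = k.
Proof.
have eq_nd : n * degree (Ffam n k) x = #|Ffam n k| * k.
  have := sum_degree (Ffam n k).
  rewrite (eq_bigr (fun=> degree (Ffam n k) x)) => [|y _]; last first.
    exact: shift_closed_regular (@Ffam_closed n k) y x.
  rewrite sum_nat_const card_ord => ->.
  rewrite (eq_bigr (fun=> k)) ?sum_nat_const // => A; exact: Ffam_card.
have co_nk : coprime n k by rewrite coprime_sym /coprime /n -addn1 gcdnMDl gcdn1.
have F_gt0 : 0 < #|Ffam n k|.
  by apply/card_gt0P; exists (Lset n k); apply/imsetP; exists ord0.
have card_F : #|Ffam n k| = n.
  (* By coprimality $n$ divides the size of $F_k$, which is positive and at most $n$. *)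
  apply/eqP; rewrite eqn_leq card_Ffam_le dvdn_leq //.
  by rewrite -(Gauss_dvdl _ co_nk) -eq_nd dvdn_mulr.
by split=> //; move: eq_nd; rewrite card_F => /eqP; rewrite eqn_pmul2l // => /eqP.
Qed.

(** Complementation exchanges avoiding [x] with containing [x]. *)
Lemma card_avoid_Fbar x : #|avoid (Fbar n k) x| = degree (Ffam n k) x.
Proof.
rewrite /degree -(card_imset _ (@setC_inj _)); apply: eq_card => A.
by rewrite -[A in LHS]setCK mem_imset ?inE ?mem_Fbar ?setCK ?inE ?negbK //; apply: setC_inj.
Qed.

Lemma card_avoid_Pfam x : #|avoid (Pfam n k) x| = #|avoid (Qfam n k) x| + 1.
Proof.
have [card_F deg_F] := Ffam_card_degree x.
have -> : avoid (Pfam n k) x =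
    avoid (Ffam n k) x :|: (avoid (Qfam n k) x :\: avoid (Fbar n k) x).
  apply/setP => A; rewrite /avoid /Pfam !in_set.
  by case: (x \in A); rewrite /= ?andbF ?andbT.
(* Complements of $k$-sets have exactly $k + 1$ elements, so they lie in $Q_k$. *)
have sub_FQ : avoid (Fbar n k) x \subset avoid (Qfam n k) x.
  apply/subsetP => A; rewrite !inE mem_Fbar => /andP[/Ffam_card cardA ->].
  by rewrite cardsCs cardA card_ground; lia.
(* The union is disjoint: sizes are $k$ on one side and at least $k + 1$ on the other. *)
rewrite cardsU (_ : _ :&: _ = set0) ?cards0 ?subn0; last first.
  apply/eqP; rewrite -subset0; apply/subsetP => A.
  rewrite /avoid !in_set => /andP[/andP[/Ffam_card -> _]].
  by rewrite addn1 ltnn andbF.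
rewrite cardsD (setIidPr sub_FQ) card_avoid_Fbar deg_F.
have := degree_avoid (Ffam n k) x; rewrite card_F deg_F.
have := subset_leq_card sub_FQ; rewrite card_avoid_Fbar deg_F /n; lia.
Qed.

(** The sets counted are the subsets of the $2k$-element set [[set~ x]] of size at least $k + 1$,
    sorted by size. *)
Lemma card_avoid_Qfam x :
  #|avoid (Qfam n k) x| = \sum_(k + 1 <= i < (2 * k).+1) 'C(2 * k, i).
Proof.
have cardCx : #|[set~ x]| = 2 * k by rewrite cardsC1 card_ord.
have draws j : 'C(2 * k, j) = #|[set A : {set 'I_n} | A \subset [set~ x] & #|A| == j]|.
  by rewrite cards_draws cardCx.
have card_lt A : x \notin A -> #|A| < n.
  move=> xA; rewrite ltnS -cardCx subset_leq_card //.
  by rewrite subsetC sub1set inE.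
rewrite big_geq_mkord /= -sum1_card.
(* [inord] returns the true size here: a set avoiding [x] has fewer than $n$ elements. *)
rewrite (partition_big (fun A => inord #|A| : 'I_n) (fun i => k + 1 <= i)) /=; last first.
  by move=> A; rewrite !inE => /andP[? ?]; rewrite inordK // card_lt.
apply: eq_bigr => i le_ki; rewrite sum1_card draws.
apply: eq_card => A; rewrite !inE unfold_in /= !inE subsetC sub1set inE.
case xA: (x \in A); rewrite /= ?andbF // andbT.
rewrite -val_eqE /= inordK ?card_lt ?xA //.
by apply/andb_idl => /eqP ->.
Qed.

End OddGroundSet.

Theorem theorem2p1 (k n : nat) (hk : 3 <= k) (hn : n = 2 * k + 1) :
  [/\ regular (Pfam n k),
      intersecting (Pfam n k),
      diversity (Pfam n k) = diversity (Qfam n k) + 1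
    & diversity (Qfam n k) = \sum_(k + 1 <= i < (2 * k).+1) 'C(2 * k, i)].
Proof.
rewrite addn1 in hn; subst n.
have regP := shift_closed_regular (@Pfam_closed (2 * k).+1 k).
have regQ := shift_closed_regular (@Qfam_closed (2 * k).+1 k).
(* Regularity lets both diversities be read off at the same point. *)
rewrite (regular_diversity ord0 regP) (regular_diversity ord0 regQ).
split=> //; first exact: Pfam_intersecting.
- exact: card_avoid_Pfam.
- exact: card_avoid_Qfam.
Qed.
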